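(* Let $m$ and $d$ be positive integers with $d < 2m$. Then $\mathsf{s}_{2m}(\mathbb{Z}_2^d) = 2m + d$.
   Context: For a positive integer $m$ and a nonnegative integer $d$, $\mathsf{s}_{2m}(\mathbb{Z}_2^d)$ denotes the smallest integer $s$ such that every sequence (repetitions allowed) of length $s$ of elements of the group $\mathbb{Z}_2^d$ has a subsequence of length $2m$ whose elements sum to $0$. *)

(* Defs.v *)
From mathcomp Require Import all_boot all_order all_algebra.

Set Implicit Arguments.
Unset Strict Implicit.
Unset Printing Implicit Defensive.

Import GRing.Theory.

(* The group Z_2^d is the additive group of 'rV['Z_2]_d.  A sequence of length
   s is an s-tuple, and a subsequence is given by its set I of positions, so
   repeated terms count as different terms. *)
Definition zero_sum_subseq (d k s : nat) (x : s.-tuple 'rV['Z_2]_d) : bool :=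
  [exists I : {set 'I_s}, (#|I| == k) && (\sum_(i in I) tnth x i == 0)%R].

Definition forces_zero_sum (m d s : nat) : bool :=
  [forall x : s.-tuple 'rV['Z_2]_d, zero_sum_subseq (2 * m) x].

Lemma forces_zero_sum_exists (m d : nat) : exists s, forces_zero_sum m d s.
Proof.
pose N := #|{: 'rV['Z_2]_d}|; exists (N * (2 * m)); apply/forallP => x.
have [g le_g] : exists g, 2 * m <= #|[set i | tnth x i == g]|.
  apply/existsP; apply: contraT; rewrite negb_exists => /forallP small.
  have N_gt0 : 0 < N by apply/card_gt0P; exists 0%R.
  have m_gt0 : 0 < 2 * m by apply: leq_ltn_trans (leq0n _) (_ : _ < 2 * m);
    rewrite ltnNge; exact: (small 0%R).
  have eqN : \sum_(g : 'rV['Z_2]_d) #|[set i | tnth x i == g]| = N * (2 * m).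
    rewrite -[RHS]card_ord -sum1_card (partition_big (tnth x) predT) //=.
    by apply: eq_bigr => g _; rewrite -sum1_card; apply: eq_bigl => i; rewrite inE.
  have : N * (2 * m) <= N * (2 * m).-1.
    apply: leq_trans (eq_leq (esym eqN)) _.
    apply: (@leq_trans (\sum_(g : 'rV['Z_2]_d) (2 * m).-1)); last first.
      by rewrite sum_nat_const.
    apply: leq_sum => g _.
    by rewrite -ltnS prednK // ltnNge; exact: small.
  by rewrite leq_pmul2l // -ltnS prednK // ltnn.
have [I sI cI] : exists2 I : {set _}, I \subset [set i | tnth x i == g]
    & #|I| = 2 * m.
  set A := [set i | _] in le_g *.
  exists [set i in take (2 * m) (enum A)].
    by apply/subsetP => i; rewrite inE => /mem_take; rewrite mem_enum.
  rewrite cardsE; have /card_uniqP-> := take_uniq (2 * m) (enum_uniq A).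
  by rewrite size_takel // -cardE.
apply/existsP; exists I; rewrite cI eqxx /=.
rewrite (eq_bigr (fun _ => g)) => [|i /(subsetP sI)]; last first.
  by rewrite inE => /eqP.
rewrite sumr_const cI mulrnA; apply/eqP; suff -> : (g *+ 2 = 0)%R.
  exact: mul0rn.
by apply/rowP => j; rewrite !mxE; case: (g _ j) => [[|[|k]] ltk] //; apply/val_inj.
Qed.

(* s_{2m}(Z_2^d); the existence proof above only shows that the minimum is
   taken over a nonempty set. *)
Definition s2m (m d : nat) : nat := ex_minn (forces_zero_sum_exists m d).

(* Main.v *)
Require Import Defs.
From mathcomp Require Import all_boot.
From mathcomp Require Import all_algebra.

Set Implicit Arguments.
Unset Strict Implicit.
Unset Printing Implicit Defensive.

Import GRing.Theory.

(* Upper bound: among 2m + d points one can find disjoint pairs {a_j, b_j},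
   one for each dimension of the affine span of the points, whose differences
   a_j - b_j form a basis of its direction space.  Take one point of every pair
   and arbitrary further points to reach 2m in total: the sum is in the
   direction space, since 2m is even, and exchanging a_j for b_j in suitable
   pairs makes it 0.  The pairs are found one at a time, working modulo the
   subspace U spanned by the differences already chosen: if two points z, z'
   agree modulo U, pair z with any point not congruent to it; otherwise pair
   two points lying outside an affine basis, which exist as soon as at least two
   dimensions are left, while modulo a hyperplane two of any three points agree.

   Lower bound: 2m - 1 zeros together with a basis of Z_2^d. *)

(** * Direction spaces modulo a subspace *)

Section DirectionSpace.

Variables (K : fieldType) (V : vectType K) (T : finType) (x : T -> V).
Implicit Types (U W : {vspace V}) (S B : {set T}).

(** The direction space of the affine span of the points, enlarged by [U]: keeping [U] inside
    replaces passing to the quotient by [U]. *)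
Definition dirv U S : {vspace V} :=
  (U + \sum_(i in S) \sum_(j in S) <[x i - x j]>)%VS.

Lemma memv_dirv U S i j : i \in S -> j \in S -> (x i - x j)%R \in dirv U S.
Proof.
move=> iS jS; apply: subvP (addvSr _ _) _ _; rewrite memvE.
by apply: (sumv_sup i iS); apply: (sumv_sup j jS).
Qed.

Lemma subv_dirv U S : (U <= dirv U S)%VS.
Proof. exact: addvSl. Qed.

Lemma dirv_subP U S W z : (U <= W)%VS ->
  {in S, forall i, (x i - z)%R \in W} -> (dirv U S <= W)%VS.
Proof.
move=> sUW dW; rewrite subv_add sUW; apply/subv_sumP => i iS.
apply/subv_sumP => j jS; rewrite -memvE.
have -> : (x i - x j = (x i - z) - (x j - z))%R by rewrite opprB subrKA.
by rewrite rpredB ?dW.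
Qed.

Lemma dirvS U U' S S' : (U <= U')%VS -> S \subset S' -> (dirv U S <= dirv U' S')%VS.
Proof.
move=> sU /subsetP sS; rewrite subv_add (subv_trans sU) ?subv_dirv //.
apply/subv_sumP => i iS; apply/subv_sumP => j jS.
by rewrite -memvE memv_dirv ?sS.
Qed.

Lemma dim_add_line U (v : V) : v \notin U -> \dim (U + <[v]>) = (\dim U).+1.
Proof.
move=> vU; rewrite dimv_disjoint_sum; first by rewrite dim_vline (memPnC vU) ?mem0v ?addn1.
apply/eqP; rewrite -subv0; apply/subvP => w /memv_capP[wU /vlineP[k wk]].
move: wU; rewrite wk memv0 scaler_eq0; case: eqP => //= /eqP k0.
by rewrite rpredZeq (negPf k0) (negPf vU).
Qed.

Lemma affine_basis U S i0 : i0 \in S ->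
  exists B : {set T}, [/\ B \subset S, (dirv U S <= dirv U B)%VS
    & #|B| + \dim U <= (\dim (dirv U S)).+1].
Proof.
move=> i0S.
(* The inequality says that [B] is affinely independent modulo [U]; a maximal such [B] spans, since
   a point outside its span raises the dimension. *)
pose P (B : {set T}) :=
  [&& i0 \in B, B \subset S & #|B| + \dim U <= (\dim (dirv U B)).+1].
have P0 : P [set i0].
  by rewrite /P set11 sub1set i0S cards1 ltnS dimvS ?subv_dirv.
have [B /maxsetP[/and3P[i0B sBS leB] maxB] _] := maxset_exists P0.
exists B; split=> //; last by apply: leq_trans leB _; rewrite ltnS dimvS ?dirvS.
apply: (@dirv_subP _ _ _ (x i0)); first exact: subv_dirv.
move=> i iS; apply: contraT => dB; suff iB : i \in B by rewrite memv_dirv in dB.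
suff <- : i |: B = B by rewrite setU11.
apply: maxB; last exact: subsetUr.
rewrite /P !inE i0B orbT subUset sub1set iS sBS /=.
have iB : i \notin B by apply: contra dB => iB; apply: memv_dirv.
rewrite cardsU1 iB addSn ltnS (leq_trans leB) // -(dim_add_line dB) dimvS //.
rewrite subv_add dirvS ?subsetUr //= -memvE.
by rewrite memv_dirv ?setU11 // setU1r.
Qed.

End DirectionSpace.

(** * Exchanging pairs over the field with two elements *)

Section Binary.

Variables (V : vectType 'F_2) (T : finType) (x : T -> V).
Implicit Types (U W : {vspace V}) (S : {set T}).

Lemma memv_add_line_F2 U (v w : V) :
  w \in (U + <[v]>)%VS -> w \in U \/ (w - v)%R \in U.
Proof.
case/memv_addP => u uU [_ /vlineP[k ->] ->].
have [->|->] : k = 0%R \/ k = 1%R.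
- by case: k => [[|[|[]]] //= ?]; [left | right]; apply/val_inj.
- by left; rewrite scale0r addr0.
- by right; rewrite scale1r addrK.
Qed.

(** The final inclusion lets the search go on: deleting the pair loses no direction once its
    difference has joined the subspace. *)
Lemma exchange_pair r U S :
    ~~ (dirv x U S <= U)%VS -> \dim (dirv x U S) <= \dim U + r ->
    2 * r < #|S| ->
  exists a b, [/\ a \in S, b \in S, (x a - x b)%R \notin U
    & (dirv x U S <= dirv x (U + <[x a - x b]>) (S :\ a :\ b))%VS].
Proof.
move=> nsub dimE ltS.
have notconst z : exists2 b, b \in S & (x z - x b)%R \notin U.
  apply/exists_inP; apply: contraR nsub => /exists_inPn cst.
  apply: (@dirv_subP _ _ _ _ _ _ _ (x z)) => // i /cst.
  by rewrite negbK -opprB rpredN.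
have [/existsP[z /existsP[z' /and4P[zS z'S zz' cong]]]|/existsPn dist] :=
  boolP [exists z, exists z', [&& z \in S, z' \in S, z != z' & (x z - x z')%R \in U]].
  (* The twin [z'] replaces [z] as base point, and [b] is recovered from [z] through the new
     line. *)
  have [b bS zb] := notconst z; exists z, b; split=> //.
  have bz' : z' != b by apply: contraNneq zb => <-.
  apply: (@dirv_subP _ _ _ _ _ _ _ (x z')).
    exact: subv_trans (addvSl _ _) (subv_dirv _ _ _).
  have zz'W : (x z - x z')%R \in (U + <[x z - x b]>)%VS.
    by apply: subvP (addvSl _ _) _ cong.
  move=> i iS; have [->|iz] := eqVneq i z.
    by apply: subvP (subv_dirv _ _ _) _ zz'W.
  have [->|ib] := eqVneq i b.
    apply: subvP (subv_dirv _ _ _) _ _.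
    rewrite -(subrKA (x z)) rpredD // -(opprB (x z)) rpredN.
    by apply: subvP (addvSr _ _) _ (memv_line _).
  by apply: memv_dirv; rewrite !inE ?iz ?ib ?iS ?bz' ?z'S // eq_sym zz'.
have diff i j : i \in S -> j \in S -> i != j -> (x i - x j)%R \notin U.
  by move=> iS jS ij; move/existsPn: (dist i) => /(_ j); rewrite iS jS ij.
have [i iS] : exists i, i \in S by apply/card_gt0P; apply: leq_trans ltS.
have [B [sBS sEB leB]] := affine_basis x U iS.
have [r_le1 | r_gt1] := leqP r 1.
  have r1 : r = 1.
    case: r r_le1 dimE ltS => [|[]] // _; rewrite addn0 => dimE _.
    by case/negP: nsub; rewrite -(geq_leqif (dimv_leqif_sup (subv_dirv _ _ _))).
  have [b bS ib] := notconst i.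
  have bi : i != b by apply: contraNneq ib => <-; rewrite subrr mem0v.
  have [c] : exists c, c \in S :\ i :\ b.
    apply/card_gt0P; move: ltS; rewrite r1 (cardsD1 i) iS (cardsD1 b (S :\ i)).
    by rewrite !inE bS eq_sym bi.
  rewrite !inE => /and3P[cb ci cS].
  (* As [r = 1], one line exhausts the directions, so the third point [c] is congruent to [i] or to
     [b] modulo [U]. *)
  have sE : (dirv x U S <= U + <[x i - x b]>)%VS.
    have sub : (U + <[x i - x b]> <= dirv x U S)%VS.
      by rewrite subv_add subv_dirv -memvE memv_dirv.
    rewrite -(geq_leqif (dimv_leqif_sup sub)) dim_add_line //.
    by move: dimE; rewrite r1 addn1.
  have /memv_add_line_F2[] := subvP sE _ (memv_dirv x U cS bS).
    by rewrite (negPf (diff _ _ cS bS cb)).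
  by rewrite opprB subrKA (negPf (diff _ _ cS iS ci)).
(* At most [r.+1] of at least [2 * r + 1] points lie in [B], so at least [r >= 2] remain. *)
have ltR : 1 < #|S :\: B|.
  rewrite cardsD (setIidPr sBS) ltn_subRL.
  have leB1 : #|B| <= r.+1.
    by rewrite -(leq_add2r (\dim U)) (leq_trans leB) // addSn ltnS (addnC r).
  apply: leq_trans ltS; rewrite ltnS mul2n -addnn.
  by rewrite (leq_trans (leq_add leB1 (leqnn 1))) // addn1 -addn2 leq_add2l.
have [a [b [aR bR ab]]] := card_gt1P ltR.
move: aR bR; rewrite !inE => /andP[aB aS] /andP[bB bS].
exists a, b; split; rewrite ?diff //.
apply: subv_trans sEB _; apply: dirvS; first exact: addvSl.
by rewrite !subsetD1 sBS aB bB.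
Qed.

(** All points agree modulo [U], so any [n] of them sum to [n] times one point, which is [g] modulo
    [U]. *)
Lemma sum_mem_dirv0 n U S (g : V) :
    0 < n -> n <= #|S| -> (dirv x U S <= U)%VS ->
    {in S, forall i, (g - x i *+ n)%R \in dirv x U S} ->
  exists2 I : {set T}, I \subset S /\ #|I| = n
    & (\sum_(i in I) x i - g)%R \in U.
Proof.
move=> n_gt0 leS sEU gE.
have /card_gt0P[I] : 0 < #|[set I : {set T} | I \subset S & #|I| == n]|.
  by rewrite cards_draws bin_gt0.
rewrite inE => /andP[sIS /eqP cI]; exists I; first by [].
have /card_gt0P[i iI] : 0 < #|I| by rewrite cI.
have iS := subsetP sIS i iI.
have -> : (\sum_(j in I) x j - g = \sum_(j in I) (x j - x i) - (g - x i *+ n))%R.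
  by rewrite sumrB sumr_const cI opprB subrKA.
apply: subvP sEU _ _; rewrite rpredB ?gE //.
by apply: rpred_sum => j /(subsetP sIS) jS; apply: memv_dirv.
Qed.

(** Each of at most [r] pairs gives one point; [r < n] leaves at least one further point to choose,
    and [n + r <= #|S|] makes room for the rejected partners. *)
Lemma sum_mem_coset r n U S (g : V) :
    r < n -> n + r <= #|S| -> \dim (dirv x U S) <= \dim U + r ->
    {in S, forall i, (g - x i *+ n)%R \in dirv x U S} ->
  exists2 I : {set T}, I \subset S /\ #|I| = n
    & (\sum_(i in I) x i - g)%R \in U.
Proof.
elim: r n U S g => [|r IH] n U S g lt_rn leS dimE gE.
  apply: sum_mem_dirv0 gE => //; first by rewrite addn0 in leS.
  by rewrite -(geq_leqif (dimv_leqif_sup (subv_dirv _ _ _))) -[leqRHS]addn0.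
have [sEU|nsub] := boolP (dirv x U S <= U)%VS.
  apply: sum_mem_dirv0 gE => //; first exact: leq_trans lt_rn.
  exact: leq_trans (leq_addr _ _) leS.
have ltS : 2 * r.+1 < #|S|.
  by rewrite mul2n -addnn (leq_trans _ leS) // -addSn leq_add2r.
have [a [b [aS bS ab sE]]] := exchange_pair nsub dimE ltS.
have a_b : a != b by apply: contraNneq ab => ->; rewrite subrr mem0v.
case: n lt_rn leS gE => // n lt_rn leS gE.
set U' := (U + _)%VS in sE; set S' := S :\ a :\ b in sE.
have sS : S' \subset S by rewrite /S' !subDset !subsetU ?subxx ?orbT.
have cS : #|S| = #|S'|.+2 by rewrite (cardsD1 a) aS (cardsD1 b (S :\ a)) !inE bS eq_sym a_b.
have sE' : (dirv x U' S' <= dirv x U S)%VS.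
  apply: (@dirv_subP _ _ _ _ _ _ _ (x a)).
    by rewrite subv_add subv_dirv -memvE memv_dirv.
  by move=> i /(subsetP sS) iS; rewrite memv_dirv.
(* With the pair set aside, [n] points reach [g - x a] modulo [U']; adding [a] or [b] then gives [g]
   modulo [U]. *)
have [||||I [sI cI]] := IH n U' S' (g - x a)%R.
- exact: lt_rn.
- by move: leS; rewrite cS addSn addnS.
- by rewrite dim_add_line // addSnnS (leq_trans (dimvS sE')).
- move=> i /(subsetP sS) iS; apply: subvP sE _ _.
  have -> : (g - x a - x i *+ n = (g - x i *+ n.+1) + (x i - x a))%R.
    by rewrite mulrSr opprD !addrA subrK addrAC.
  by rewrite rpredD ?gE ?memv_dirv.
have [aI bI] : a \notin I /\ b \notin I.
  by split; apply/negP => /(subsetP sI); rewrite !inE eqxx ?andbF.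
have sIS := subset_trans sI sS.
case/memv_add_line_F2 => sumU.
- exists (a |: I); first by rewrite subUset sub1set aS sIS cardsU1 aI cI.
  by rewrite big_setU1 //=; move: sumU; rewrite opprB addrCA addrA.
- exists (b |: I); first by rewrite subUset sub1set bS sIS cardsU1 bI cI.
  rewrite big_setU1 //=; move: sumU; set s := (\sum_(i in I) x i)%R.
  by rewrite !opprB -(addrA s) [(x a - g + _)%R]addrC subrKA addrCA addrA.
Qed.

End Binary.

(** * The two bounds *)

Lemma forces_zero_sum_ub (m d : nat) : d < 2 * m -> forces_zero_sum m d (2 * m + d).
Proof.
move=> hdm; apply/forallP => x; apply/existsP.
(* ['F_2] is convertible to ['Z_2] and carries the field structure that subspaces need. *)
have mulr2m (v : 'rV['F_2]_d) : (v *+ (2 * m) = 0)%R.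
  apply/rowP => j; rewrite mulmxnE -mulr_natl natrM.
  by rewrite (pchar_Fp_0 (isT : prime 2)) !mul0r mxE.
have [||||I [_ cI]] := @sum_mem_coset 'rV['F_2]_d _ (tnth x) d (2 * m) 0%VS setT 0%R.
- exact: hdm.
- by rewrite cardsT card_ord.
- by rewrite dimv0 (leq_trans (dimvS (subvf _))) // dimvf /dim /= mul1n.
- by move=> i _; rewrite mulr2m subrr mem0v.
by rewrite memv0 subr0 => sI; exists I; rewrite cI eqxx.
Qed.

(** The test sequence lists the unit vectors, then zeros. A chosen unit vector leaves a 1 in its own
    coordinate, so a zero-sum choice avoids the first [d] positions. *)
Lemma forces_zero_sum_lb (m d s : nat) : 0 < m -> forces_zero_sum m d s -> 2 * m + d <= s.
Proof.
move=> m_gt0 /forallP/(_ [tuple (\row_(j < d) (i == j :> nat)%:R)%R | i < s]).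
case/existsP => I /andP[/eqP cI /eqP sI].
have geI i : i \in I -> d <= i.
  move=> iI; rewrite leqNgt; apply/negP => lt_id.
  have := congr1 (fun v : 'rV_d => v ord0 (Ordinal lt_id)) sI.
  rewrite summxE (bigD1 i) //= tnth_mktuple !mxE eqxx big1 ?addr0 //.
  by move=> j /andP[_ ji]; rewrite tnth_mktuple mxE /= (inj_eq val_inj) (negPf ji).
have [lt_sd|le_ds] := ltnP s d.
  have /card_gt0P[i /geI] : 0 < #|I| by rewrite cI muln_gt0.
  by rewrite leqNgt (ltn_trans (ltn_ord i)).
have inj : injective (widen_ord le_ds).
  by move=> i j /(congr1 val) /= /ord_inj.
rewrite -cI -[leqRHS]card_ord -(cardsC I) leq_add2l.
rewrite -[leqLHS]card_ord -(card_imset _ inj) subset_leq_card //.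
apply/subsetP => _ /imsetP[j _ ->]; rewrite inE; apply/negP => /geI.
by rewrite /= leqNgt ltn_ord.
Qed.

Theorem theorem10 (m d : nat) (hm : 0 < m) (hd : 0 < d) (hdm : d < 2 * m) :
  s2m m d = 2 * m + d.
Proof.
rewrite /s2m; case: ex_minnP => s fs min_s; apply/eqP; rewrite eqn_leq.
by rewrite min_s ?forces_zero_sum_ub // forces_zero_sum_lb.
Qed.
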